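(* Let $m\ge4$ be an integer and $a,b$ complex numbers. Let $f_m(z,a,b)=\sum_{n\ge0}c(n,m,a,b)z^n$ be the unique formal power series with $f_m=1+azf_m+bz^mf_m^2$, and $d_2^{(m)}(N,a,b)=\det\big(c(i+j+2,m,a,b)\big)_{i,j=0}^{N-1}$. Then $$d_2^{(m)}(mn+1,a,b)=(-1)^{n\binom{m-1}2}(n+1)^2a^2b^{mn^2+3n}\quad(n\ge0),$$ $$d_2^{(m)}(mn-2,a,b)=-(-1)^{n\binom{m-1}2}n^2a^2b^{mn^2-3n}\quad(n\ge1).$$ *)

(* Defs.v *)
From mathcomp Require Import all_boot all_order all_algebra.
From mathcomp Require Import boolp.
From mathcomp Require Export complex.
From mathcomp Require Export reals.

Set Implicit Arguments.
Unset Strict Implicit.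
Unset Printing Implicit Defensive.

Import GRing.Theory.
Local Open Scope ring_scope.

(* A formal power series is its sequence of coefficients: f n = [z^n] f. *)
Definition fps (K : Type) := nat -> K.

Declare Scope fps_scope.
Delimit Scope fps_scope with fps.
Bind Scope fps_scope with fps.

Section Fps.
Variable K : comNzRingType.
Implicit Types f g : fps K.

Definition fps_one : fps K := fun n => (n == 0%N)%:R.
Definition fps_Xn (m : nat) : fps K := fun n => (n == m)%:R.
Definition fps_add f g : fps K := fun n => f n + g n.
Definition fps_scale (c : K) f : fps K := fun n => c * f n.
Definition fps_mul f g : fps K := fun n => \sum_(i < n.+1) f i * g (n - i)%N.

Definition hankel_det (r : nat) f (N : nat) : K :=
  \det (\matrix_(i < N, j < N) f (i + j + r)%N).

End Fps.

Arguments fps_one {K}.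
Arguments fps_Xn {K} m.

Notation "1" := fps_one : fps_scope.
Notation "''z^' m" := (fps_Xn m)
  (at level 1, format "''z^' m") : fps_scope.
Notation "''z'" := (fps_Xn 1) (at level 0) : fps_scope.
Notation "f + g" := (fps_add f%fps g%fps) : fps_scope.
Notation "f * g" := (fps_mul f%fps g%fps) : fps_scope.
Notation "c *: f" := (fps_scale c%R f%fps) : fps_scope.

(* The equation defining f_m has exactly one solution (for every m >= 1). *)
Section Solution.
Variables (K : comNzRingType) (m : nat) (a b : K).

Let T (f : fps K) : fps K := (1 + a *: ('z * f) + b *: ('z^m * (f * f)))%fps.

Let T_ext f g n : (0 < m)%N ->
  (forall k, (k < n)%N -> f k = g k) -> T f n = T g n.
Proof.
move=> m0 fg; rewrite /T /fps_add /fps_scale.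
congr (_ + _ * _ + _ * _); apply: eq_bigr => -[i /= lei] _; rewrite /fps_Xn.
  case: eqP => [i1|_]; last by rewrite !mul0r.
  by rewrite fg // i1 ltn_subrL; move: lei; rewrite i1.
case: eqP => [im|_]; last by rewrite !mul0r.
have lt k : (k <= n - i)%N -> (k < n)%N.
  move=> /leq_ltn_trans; apply; rewrite ltn_subrL im m0.
  by rewrite (leq_trans m0) // -im.
congr (_ * _); rewrite /fps_mul; apply: eq_bigr => -[j /= lej] _.
by rewrite !fg // lt // leq_subr.
Qed.

Lemma fps_solution_unique : (0 < m)%N ->
  exists! f : fps K, f = (1 + a *: ('z * f) + b *: ('z^m * (f * f)))%fps.
Proof.
move=> m0; pose s k := iter k T (fun=> 0).
have s_stable k n : (n < k)%N -> s k.+1 n = s k n.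
  elim: k n => // k IH n ltnk; apply: T_ext => // j ltj.
  by apply: IH; apply: leq_trans ltj _.
have s_stab d n : s (n.+1 + d)%N n = s n.+1 n.
  elim: d => [|d IH]; first by rewrite addn0.
  by rewrite addnS s_stable ?IH // addSn ltnS leq_addr.
exists (fun n => s n.+1 n); split.
  apply/funext => n; apply: (@T_ext (s n)) => // k ltk.
  by rewrite -(subnKC ltk) s_stab.
move=> g gE; apply/funext => n.
have sg k j : (j < k)%N -> s k j = g j.
  elim: k j => // k IH j ltj; rewrite gE; apply: T_ext => // i lti.
  by apply: IH; apply: leq_trans lti _.
exact: sg.
Qed.

End Solution.

(* Main.v *)
Require Import Defs.
From HB Require Import structures.
From mathcomp Require Import all_boot all_order all_algebra.
From mathcomp Require Import complex reals boolp ring zify.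
Import GRing.Theory.
Local Open Scope ring_scope.
Local Open Scope complex_scope.

(** The Hankel matrix of f has generating function
    H = (x f(x) - y f(y)) / (x - y), and multiplying it by u(x) u(y) with
    u(0) = 1 does not change its leading principal minors.  Since
    1/f = 1 - a z - b z^m f, two divisions by f(x) f(y) turn H into the block
    diagonal 1 (+) b A (+) b^2 H, where A is antitriangular of size m - 1.
    The shifted determinant is
    d_2(N) = det (H + e_0 e_0^T) - det H in size N + 1, and in the sizes
    mn + 2 and mn - 1 the second term vanishes.  The same divisions send the
    rank-one perturbation by g_k = 1 - k a z f to the one by - b g_{k+1} on the
    last block; because H is singular there, only that block sees the
    perturbation, so that the determinant of H + g_k g_k^T obeys a recursion
    with step m in the size and step 1 in k, starting from g_0 = 1. *)

(** * The commutative ring of formal power series *)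

Section FpsRing.
Set Implicit Arguments.
Unset Strict Implicit.
Variable K : comNzRingType.
Implicit Types u v w : fps K.

HB.instance Definition _ := gen_eqMixin (fps K).
HB.instance Definition _ := gen_choiceMixin (fps K).

Definition fps_zero : fps K := fun=> 0.
Definition fps_opp u : fps K := fun n => - u n.

Lemma fps_addA : associative (@fps_add K).
Proof. by move=> u v w; apply/funext => n; rewrite /fps_add addrA. Qed.
Lemma fps_addC : commutative (@fps_add K).
Proof. by move=> u v; apply/funext => n; rewrite /fps_add addrC. Qed.
Lemma fps_add0 : left_id fps_zero (@fps_add K).
Proof. by move=> u; apply/funext => n; rewrite /fps_add add0r. Qed.
Lemma fps_addN : left_inverse fps_zero fps_opp (@fps_add K).
Proof. by move=> u; apply/funext => n; rewrite /fps_add addNr. Qed.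

HB.instance Definition _ :=
  GRing.isZmodule.Build (fps K) fps_addA fps_addC fps_add0 fps_addN.

Definition fps_trunc (L : nat) u : {poly K} := \poly_(i < L) u i.

(** A coefficient of a product involves only coefficients of lower or equal index, so commutativity
    and associativity can be inherited from polynomials. *)
Lemma fps_mul_trunc L u v n : (n < L)%N ->
  fps_mul u v n = (fps_trunc L u * fps_trunc L v)`_n.
Proof.
move=> nL; rewrite coefM; apply: eq_bigr => i _; rewrite !coef_poly.
have iL : (i < L)%N by case: i => i /= ?; lia.
have jL : (n - i < L)%N by lia.
by rewrite iL jL.
Qed.

Lemma fps_mulC : commutative (@fps_mul K).
Proof.
move=> u v; apply/funext => n.
by rewrite !(@fps_mul_trunc n.+1) // mulrC.
Qed.

Lemma fps_mulA : associative (@fps_mul K).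
Proof.
move=> u v w; apply/funext => n; set L := n.+1.
have tr s t i : (i < L)%N ->
    (fps_trunc L (fps_mul s t))`_i = (fps_trunc L s * fps_trunc L t)`_i.
  by move=> iL; rewrite coef_poly iL (@fps_mul_trunc L).
rewrite (@fps_mul_trunc L) // [RHS](@fps_mul_trunc L) //.
transitivity (fps_trunc L u * fps_trunc L v * fps_trunc L w)`_n.
  rewrite -mulrA !coefM; apply: eq_bigr => i _; congr (_ * _).
  by rewrite tr // /L; case: i => i /= ?; lia.
rewrite !coefM; apply: eq_bigr => i _; congr (_ * _).
by rewrite tr // /L; case: i => i /= ?; lia.
Qed.

Lemma fps_mul1 : left_id (@fps_one K) (@fps_mul K).
Proof.
move=> u; apply/funext => n; rewrite /fps_mul big_ord_recl /= mul1r subn0.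
by rewrite big1 ?addr0 // => i _; rewrite /fps_one /= mul0r.
Qed.

Lemma fps_mulDl : left_distributive (@fps_mul K) (@fps_add K).
Proof.
move=> u v w; apply/funext => n; rewrite /fps_mul /fps_add -big_split /=.
by apply: eq_bigr => i _; rewrite mulrDl.
Qed.

Lemma fps_one_neq0 : @fps_one K != 0.
Proof.
by apply/eqP => /(congr1 (fun u : fps K => u 0%N)) /eqP; rewrite oner_eq0.
Qed.

HB.instance Definition _ := GRing.Zmodule_isComNzRing.Build (fps K)
  fps_mulA fps_mulC fps_mul1 fps_mulDl fps_one_neq0.

Lemma fps0E n : (0 : fps K) n = 0. Proof. by []. Qed.
Lemma fps1E n : (1 : fps K) n = (n == 0%N)%:R. Proof. by []. Qed.
Lemma fpsDE u v n : (u + v) n = u n + v n. Proof. by []. Qed.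
Lemma fpsNE u n : (- u) n = - u n. Proof. by []. Qed.
Lemma fpsME u v n : (u * v) n = \sum_(i < n.+1) u i * v (n - i)%N.
Proof. by []. Qed.
Lemma fps_sumE (I : finType) (F : I -> fps K) n :
  (\sum_i F i) n = \sum_i F i n.
Proof. by elim/big_rec2: _ => // i x y _ <-. Qed.

Definition fps_cst (c : K) : fps K := fun n => c *+ (n == 0%N).

Lemma fps_cstM c u n : (fps_cst c * u) n = c * u n.
Proof.
rewrite fpsME big_ord_recl /= subn0 big1 ?addr0 // => i _.
by rewrite /fps_cst /= mulr0n mul0r.
Qed.

Lemma fps_cst_is_zmod : zmod_morphism fps_cst.
Proof.
by move=> c d; apply/funext => n; rewrite fpsDE fpsNE /fps_cst mulrnBl.
Qed.
Lemma fps_cst_is_monoid : monoid_morphism fps_cst.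
Proof.
split; first by apply/funext => n.
by move=> c d; apply/funext => n; rewrite fps_cstM /fps_cst mulrnAr.
Qed.
HB.instance Definition _ :=
  GRing.isZmodMorphism.Build K (fps K) fps_cst fps_cst_is_zmod.
HB.instance Definition _ :=
  GRing.isMonoidMorphism.Build K (fps K) fps_cst fps_cst_is_monoid.

Lemma fps_scaleE c u : fps_scale c u = fps_cst c * u.
Proof. by apply/funext => n; rewrite fps_cstM. Qed.

Lemma fps_XnM s u n :
  (fps_Xn s * u) n = if (s <= n)%N then u (n - s)%N else 0.
Proof.
rewrite fpsME; case: leqP => [sn|ns].
  rewrite (bigD1 (Ordinal (sn : (s < n.+1)%N))) //= /fps_Xn eqxx mul1r.
  rewrite big1 ?addr0 // => i /negbTE.
  by rewrite -val_eqE /= => ->; rewrite mul0r.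
rewrite big1 // => -[i /= ilt] _; rewrite /fps_Xn.
by case: eqP => [E|_]; [lia | rewrite mul0r].
Qed.

Lemma fps_Xn_add s t : fps_Xn s * fps_Xn t = fps_Xn (s + t) :> fps K.
Proof.
apply/funext => n; rewrite fps_XnM /fps_Xn.
by case: leqP => H; [congr (_%:R) | case: eqP => //]; lia.
Qed.

End FpsRing.

(** * Bivariate series, Hankel generating functions and their leading corners *)

Section Bivariate.
Set Implicit Arguments.
Unset Strict Implicit.
Variable K : comNzRingType.
Implicit Types (u v w : fps K) (M A : fps (fps K)).

(* A bivariate series M has the coefficient M j i at x^i y^j. *)
Definition inX (u : fps K) : fps (fps K) := fps_cst u.
Definition inY (u : fps K) : fps (fps K) := fun j => fps_cst (u j).
Arguments inX u%_R.
Arguments inY u%_R.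

HB.instance Definition _ := GRing.RMorphism.copy inX (@fps_cst (fps K)).

Lemma inY_is_zmod : zmod_morphism inY.
Proof. by move=> u v; apply/funext => j; rewrite /inY rmorphB. Qed.
Lemma inY_is_monoid : monoid_morphism inY.
Proof.
split; first by apply/funext => j; rewrite /inY fps1E rmorph_nat.
move=> u v; apply/funext => j.
by rewrite fpsME /inY fpsME rmorph_sum; apply: eq_bigr => q _; rewrite rmorphM.
Qed.
HB.instance Definition _ :=
  GRing.isZmodMorphism.Build (fps K) (fps (fps K)) inY inY_is_zmod.
HB.instance Definition _ :=
  GRing.isMonoidMorphism.Build (fps K) (fps (fps K)) inY inY_is_monoid.

Lemma inX_mulE u M j : (inX u * M) j = u * M j.
Proof. exact: fps_cstM. Qed.

Lemma inY_mulE u M j i :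
  (M * inY u) j i = \sum_(q < j.+1) M q i * u (j - q)%N.
Proof.
rewrite fpsME fps_sumE; apply: eq_bigr => q _.
by rewrite mulrC fps_cstM mulrC.
Qed.

Lemma inY_cst c : inY (fps_cst c) = inX (fps_cst c).
Proof.
apply/funext => j; rewrite /inY /inX /fps_cst.
by case: j => [|j] /=; rewrite ?mulr1n // !mulr0n; apply/funext => -[].
Qed.

Lemma inY_Xn s : inY (fps_Xn s) = fps_Xn s.
Proof. by apply/funext => j; rewrite /inY /fps_Xn rmorph_nat. Qed.

Lemma inX_XnE s M j i :
  (inX (fps_Xn s) * M) j i = if (s <= i)%N then M j (i - s)%N else 0.
Proof. by rewrite inX_mulE fps_XnM. Qed.

Lemma inY_XnE s M j i :
  (inY (fps_Xn s) * M) j i = if (s <= j)%N then M (j - s)%N i else 0.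
Proof. by rewrite inY_Xn fps_XnM; case: ifP. Qed.

(** The factor x - y is regular over any coefficient ring: if it kills D, then D j (i - 1) = D (j -
    1) i, with out-of-range terms read as 0, and D vanishes by induction on j. This is how the
    quotient by x - y is handled without division. *)
Lemma subXY_cancel M M' :
  (inX (fps_Xn 1) - inY (fps_Xn 1)) * M =
  (inX (fps_Xn 1) - inY (fps_Xn 1)) * M' -> M = M'.
Proof.
move=> /eqP; rewrite -subr_eq0 -mulrBr => /eqP; set D := M - M' => D0.
suff: D = 0 by move=> /eqP; rewrite subr_eq0 => /eqP.
have rel j i : (if (1 <= i)%N then D j (i - 1)%N else 0)
             = (if (1 <= j)%N then D (j - 1)%N i else 0).
  have := congr1 (fun N : fps (fps K) => N j i) D0.
  rewrite mulrBl !fpsDE !fpsNE inX_XnE inY_XnE => /eqP.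
  by rewrite subr_eq0 => /eqP.
apply/funext; elim=> [|j IH]; apply/funext => i.
  by have := rel 0%N i.+1; rewrite /= subn1.
by have := rel j.+1 i.+1; rewrite /= !subn1 /= IH => ->.
Qed.

Definition hankel_fps (u : fps K) : fps (fps K) := fun j i => u (i + j)%N.
Arguments hankel_fps u%_R.

Lemma hankel_fpsP u :
  (inX (fps_Xn 1) - inY (fps_Xn 1)) * hankel_fps u =
  inX (fps_Xn 1 * u) - inY (fps_Xn 1 * u).
Proof.
apply/funext => j; apply/funext => i.
rewrite mulrBl !fpsDE !fpsNE inX_XnE inY_XnE /hankel_fps.
have z0 : (fps_Xn 1 * u) 0%N = 0 by rewrite fps_XnM.
have zS n : (fps_Xn 1 * u) n.+1 = u n by rewrite fps_XnM subn1.
move: (fps_Xn 1 * u) z0 zS => v v0 vS; rewrite /inX /inY /fps_cst.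
case: j i => [|j] [|i]; rewrite /= ?mulr1n ?mulr0n ?fps0E ?v0 ?vS ?subn1 ?addn0.
- by [].
- by rewrite subr0.
- by rewrite add0n.
- by rewrite addnS addSn !subrr.
Qed.

Definition corner (N : nat) M : 'M[K]_N := \matrix_(i, j) M j i.
(** Multiplication by u in the basis of powers of z; being lower triangular, it is compatible with
    leading corners of every size. *)
Definition toeplitz (N : nat) u : 'M[K]_N :=
  \matrix_(i, j) if (j <= i)%N then u (i - j)%N else 0.
Definition fps_col (N : nat) u : 'cV[K]_N := \col_i u i.
Arguments corner N%_N M%_R.
Arguments fps_col N%_N u%_R.

Lemma cornerD N M M' : corner N (M + M') = corner N M + corner N M'.
Proof. by apply/matrixP => i j; rewrite !mxE. Qed.

Lemma cornerZ N c M : corner N (inX (fps_cst c) * M) = c *: corner N M.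
Proof. by apply/matrixP => i j; rewrite !mxE inX_mulE fps_cstM. Qed.

Lemma corner_rank1 N u :
  corner N (inX u * inY u) = fps_col N u *m (fps_col N u)^T.
Proof.
apply/matrixP => i j; rewrite !mxE big_ord1 !mxE inX_mulE.
by rewrite mulrC fps_cstM mulrC.
Qed.

Lemma cornerX N u M : corner N (inX u * M) = toeplitz N u *m corner N M.
Proof.
apply/matrixP => i j; rewrite !mxE inX_mulE mulrC fpsME.
rewrite (big_ord_widen N (fun q => M j q * u (i - q)%N)) //.
rewrite big_mkcond; apply: eq_bigr => q _; rewrite !mxE ltnS.
by case: ifP; rewrite ?mul0r // mulrC.
Qed.

Lemma cornerY N u M : corner N (inY u * M) = corner N M *m (toeplitz N u)^T.
Proof.
apply/matrixP => i j; rewrite !mxE mulrC inY_mulE.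
rewrite (big_ord_widen N (fun q => M q i * u (j - q)%N)) //.
rewrite big_mkcond; apply: eq_bigr => q _; rewrite !mxE ltnS.
by case: ifP; rewrite ?mulr0.
Qed.

Lemma det_toeplitz N u : u 0%N = 1 -> \det (toeplitz N u) = 1.
Proof.
move=> u0; rewrite det_trig.
  by rewrite big1 // => i _; rewrite mxE leqnn subnn.
by apply/is_trig_mxP => i j ij; rewrite mxE leqNgt ij.
Qed.

Lemma det_corner_mul N u M : u 0%N = 1 ->
  \det (corner N (inX u * inY u * M)) = \det (corner N M).
Proof.
move=> u0; rewrite -mulrA cornerX cornerY !det_mulmx det_tr.
by rewrite !det_toeplitz // mul1r mulr1.
Qed.

Lemma corner_block s N A M :
  (forall i j, (s <= i)%N || (s <= j)%N -> A j i = 0) ->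
  corner (s + N) (A + inX (fps_Xn s) * inY (fps_Xn s) * M) =
  block_mx (corner s A) 0 0 (corner N M).
Proof.
move=> A0; apply/matrixP => i j.
rewrite mxE !fpsDE -mulrA inX_XnE inY_XnE.
case: (split_ordP i) => i' ->; case: (split_ordP j) => j' ->;
  rewrite ?block_mxEul ?block_mxEur ?block_mxEdl ?block_mxEdr !mxE /=.
- by rewrite leqNgt ltn_ord addr0.
- by rewrite leqNgt ltn_ord addr0 A0 // leq_addr orbT.
- rewrite leq_addr (leqNgt s j') ltn_ord addr0.
  by rewrite A0 // leq_addr.
- by rewrite !leq_addr !addKn A0 ?leq_addr // add0r.
Qed.

Lemma fps_col_block s N w u : (forall i, (s <= i)%N -> w i = 0) ->
  fps_col (s + N) (w + fps_Xn s * u) = col_mx (fps_col s w) (fps_col N u).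
Proof.
move=> w0; apply/matrixP => i j; rewrite mxE fpsDE fps_XnM.
case: (split_ordP i) => i' ->; rewrite ?col_mxEu ?col_mxEd !mxE /=.
  by rewrite leqNgt ltn_ord addr0.
by rewrite leq_addr addKn w0 ?leq_addr // add0r.
Qed.

End Bivariate.

(** * Antitriangular determinants and rank-one perturbations of block diagonals *)

(** Only the last entry of the first row survives the expansion, and its cofactor is again
    antitriangular; the sign follows Pascal's rule. Entries past the antidiagonal are arbitrary,
    which accommodates the terms in -a of [antidiag]. *)
Lemma det_antitriangular (K : comNzRingType) s (M : 'M[K]_s) :
  (forall i j : 'I_s, (i + j < s.-1)%N -> M i j = 0) ->
  (forall i j : 'I_s, (i + j)%N = s.-1 -> M i j = 1) ->
  \det M = (-1) ^+ 'C(s, 2).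
Proof.
elim: s M => [|s IH] M M0 M1; first by rewrite det_mx00.
rewrite (expand_det_row _ ord0) (bigD1 ord_max) //= M1 // mul1r big1 => [|j].
  rewrite addr0 /cofactor IH => [|i j ij|i j ij].
  - by rewrite add0n -exprD binS bin1 addnC.
  - rewrite !mxE M0 //= /bump leq0n; case: j ij => j /= js ij.
    by rewrite (_ : (s <= j)%N = false); lia.
  - rewrite !mxE M1 //= /bump leq0n; case: j ij => j /= js ij.
    by rewrite (_ : (s <= j)%N = false); lia.
rewrite -val_eqE /= => js; rewrite M0 ?mul0r //=.
by case: j js => j /=; lia.
Qed.

(* A kernel vector of M2 that is not orthogonal to w2 reproduces the row
   (w1^T, w2^T), which clears the perturbation from the first block row. *)
Lemma det_block_rank1 (K : fieldType) p q (M1 : 'M[K]_p) (M2 : 'M[K]_q)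
    (w1 : 'cV[K]_p) (w2 : 'cV[K]_q) :
  \det M2 = 0 ->
  \det (block_mx M1 0 0 M2 + col_mx w1 w2 *m (col_mx w1 w2)^T) =
  \det M1 * \det (M2 + w2 *m w2^T).
Proof.
move=> /eqP/det0P [v v0 vM2].
rewrite tr_col_mx mul_col_row add_block_mx !add0r.
have vR : v *m row_mx (w2 *m w1^T) (M2 + w2 *m w2^T) =
    (v *m w2) *m row_mx w1^T w2^T.
  by rewrite !mul_mx_row mulmxDr vM2 add0r !mulmxA.
have [c0|c_neq0] := eqVneq ((v *m w2) 0 0) 0.
  (* In the orthogonal case both sides vanish: v kills the perturbed second block, and (0, v) kills
     the whole matrix. *)
  have vw0 : v *m w2 = 0 by rewrite [LHS]mx11_scalar c0 raddf0.
  have -> : \det (M2 + w2 *m w2^T) = 0.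
    apply/eqP/det0P; exists v => //.
    by rewrite mulmxDr vM2 add0r mulmxA vw0 mul0mx.
  rewrite mulr0; apply/eqP/det0P; exists (row_mx 0 v).
    apply: contraNneq v0 => /eqP; rewrite -row_mx0 => /eqP /eq_row_mx [_ ->].
    by [].
  rewrite mul_row_block !mul0mx !add0r -mul_mx_row vR.
  by rewrite vw0 mul0mx.
set c := (v *m w2) 0 0 in c_neq0.
pose u := c^-1 *: v.
have uw : u *m w2 = 1%:M.
  by rewrite -scalemxAl [v *m w2]mx11_scalar -/c scale_scalar_mx mulVf.
have uM : u *m M2 = 0 by rewrite -scalemxAl vM2 scaler0.
have E : block_mx 1%:M (- (w1 *m u)) 0 1%:M *m
    block_mx (M1 + w1 *m w1^T) (w1 *m w2^T) (w2 *m w1^T) (M2 + w2 *m w2^T) =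
    block_mx M1 0 (w2 *m w1^T) (M2 + w2 *m w2^T).
  rewrite mulmx_block !mul1mx !mul0mx !add0r !mulNmx; congr block_mx.
    by rewrite mulmxA -(mulmxA w1 u) uw mulmx1 addrK.
  rewrite mulmxDr -(mulmxA w1 u M2) uM mulmx0 add0r.
  by rewrite mulmxA -(mulmxA w1 u) uw mulmx1 subrr.
rewrite -(det_lblock M1 (w2 *m w1^T)) -E det_mulmx det_ublock !det1.
by rewrite !mul1r.
Qed.

#[global] Arguments inX {K} u%_R.
#[global] Arguments inY {K} u%_R.
#[global] Arguments hankel_fps {K} u%_R.
#[global] Arguments corner {K} N%_N M%_R.
#[global] Arguments fps_col {K} N%_N u%_R.

(** * The two divisions by f(x) f(y), for the Hankel series and for the border *)

Section Recursion.
Set Implicit Arguments.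
Unset Strict Implicit.
Variables (K : fieldType) (s : nat) (a b : K) (f : fps K).

Local Notation z := (fps_Xn 1 : fps K).
Local Notation zs := (fps_Xn s : fps K).
Local Notation c := (@fps_cst K).

(** Here m = s + 3, so the antitriangular block has size m - 1 = s + 2. *)
Hypothesis fE : f = 1 + c a * (z * f) + c b * (fps_Xn s.+3 * (f * f)).

Lemma fps_Xn_split : [/\ fps_Xn s.+1 = zs * z, fps_Xn s.+2 = zs * z * z
                       & fps_Xn s.+3 = zs * z * z * z].
Proof. by split; rewrite !fps_Xn_add !addn1. Qed.

Lemma solution_coef0 : f 0%N = 1.
Proof. by rewrite fE !fpsDE !fps_cstM !fps_XnM /= !mulr0 !addr0. Qed.

(** The Hankel series of z^(m-2) f, times b, is what the first division leaves after the block 1. *)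
Definition tail : fps K := (fps_Xn s.+1 * f)%R.

(** The block A of the header, written with Hankel series so that [hankel_fpsP] still applies to
    it. *)
Definition antidiag : fps (fps K) :=
  (hankel_fps (fps_Xn s.+1)
   - inX (c a) * (inX z * (inY z * hankel_fps zs)))%R.

(* The series g_k of the header. *)
Definition border (k : nat) : fps K := (1 - c (k%:R * a) * (z * f))%R.

(** This is h_k = (g_k / f - 1) / z, the part of the border that remains after the first
    division. *)
Definition border_tail (k : nat) : fps K :=
  (- c (k.+1%:R * a) - c b * (fps_Xn s.+2 * f))%R.

Lemma hankel_fE : hankel_fps f =
  inX f * inY f * (1 + inX z * inY z * (inX (c b) * hankel_fps tail)).
Proof.
apply: subXY_cancel; rewrite hankel_fpsP.
transitivity (inX f * inY f * (inX z - inY z + inX z * inY z * inX (c b) *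
   ((inX z - inY z) * hankel_fps tail))); last by ring.
have [E1 E2 E3] := fps_Xn_split.
rewrite hankel_fpsP /tail E1 !rmorphM /=.
have := congr1 inX fE; have := congr1 inY fE.
rewrite E3 !rmorphD !rmorphM !rmorph1 /= !inY_cst.
move: (inX f) (inY f) (inX z) (inY z) (inX zs) (inY zs) (inX (c a)) (inX (c b)).
move=> fx fy x y xs ys ca cb Hy Hx.
apply/eqP; rewrite -subr_eq0; apply/eqP.
(* The difference is y f(y) times the equation for f(x) minus x f(x) times the equation for f(y). *)
transitivity (
  y * fy * (fx - (1 + ca * (x * fx) + cb * (xs * x * x * x * (fx * fx))))
  - x * fx * (fy - (1 + ca * (y * fy) + cb * (ys * y * y * y * (fy * fy)))));
  first by ring.
by rewrite -Hx -Hy; ring.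
Qed.

Lemma hankel_tailE : hankel_fps tail = inX f * inY f *
  (antidiag + inX (fps_Xn s.+2) * inY (fps_Xn s.+2) *
     (inX (c b) * hankel_fps f)).
Proof.
apply: subXY_cancel; rewrite hankel_fpsP.
have [E1 E2 E3] := fps_Xn_split.
transitivity (inX f * inY f * (((inX z - inY z) * hankel_fps (fps_Xn s.+1))
  - inX (c a) * inX z * inY z * ((inX z - inY z) * hankel_fps zs)
  + inX (fps_Xn s.+2) * inY (fps_Xn s.+2) * inX (c b) *
     ((inX z - inY z) * hankel_fps f))); last by rewrite /antidiag; ring.
rewrite !hankel_fpsP /tail E1 E2 !rmorphM /=.
have := congr1 inX fE; have := congr1 inY fE.
rewrite E3 !rmorphD !rmorphM !rmorph1 /= !inY_cst.
move: (inX f) (inY f) (inX z) (inY z) (inX zs) (inY zs) (inX (c a)) (inX (c b)).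
move=> fx fy x y xs ys ca cb Hy Hx.
apply/eqP; rewrite -subr_eq0; apply/eqP.
set X2 := xs * x * x; set Y2 := ys * y * y.
(* The same combination of the two equations, now with multipliers y^(m-1) f(y) and -x^(m-1)
   f(x). *)
transitivity (
  - X2 * fx * (fy - (1 + ca * (y * fy) + cb * (ys * y * y * y * (fy * fy))))
  + Y2 * fy * (fx - (1 + ca * (x * fx) + cb * (xs * x * x * x * (fx * fx)))));
  first by rewrite /X2 /Y2; ring.
by rewrite -Hx -Hy; ring.
Qed.

(** Since 1/f = 1 - a z - b z^m f, dividing g_k by f adds one more - a z; this is the source of the
    step from k to k + 1. *)
Lemma borderE k : border k = f * (1 + z * border_tail k).
Proof.
have [E1 E2 E3] := fps_Xn_split.
rewrite /border /border_tail E2; move: fE; rewrite E3 => H.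
have -> : c (k.+1%:R * a) = c (k%:R * a) + c a.
  by rewrite -rmorphD /= -natr1 mulrDl mul1r.
apply/eqP; rewrite -subr_eq0; apply/eqP.
transitivity (- (f - (1 + c a * (z * f) + c b * (zs * z * z * z * (f * f)))));
  first by ring.
by rewrite -H subrr oppr0.
Qed.

(** The second division splits h_k / f into a polynomial of degree at most 1, seen only by the block
    A, and a multiple of g_(k+1) shifted to the last block. *)
Lemma border_tailE k : border_tail k =
  f * (- c (k.+1%:R * a) * (1 - c a * z)
       + fps_Xn s.+2 * (- c b * border k.+1)).
Proof.
have [E1 E2 E3] := fps_Xn_split.
rewrite /border /border_tail E2; move: fE; rewrite E3 => H.
apply/eqP; rewrite -subr_eq0; apply/eqP.
transitivity (c (k.+1%:R * a) *
  (f - (1 + c a * (z * f) + c b * (zs * z * z * z * (f * f)))));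
  first by ring.
by rewrite -H subrr mulr0.
Qed.

(** * Block reduction of the plain and bordered determinants *)

Lemma fps2_1_supp i j : (1 <= i)%N || (1 <= j)%N ->
  (1 : fps (fps K)) j i = 0.
Proof. by case: j => [|j] // ; case: i. Qed.

Lemma corner1_1 : corner 1 (1 : fps (fps K)) = 1%:M.
Proof. by apply/matrixP => i j; rewrite !ord1 !mxE. Qed.

Lemma det_hankelS r : \det (corner (1 + r) (hankel_fps f)) =
  \det (corner r (inX (c b) * hankel_fps tail)).
Proof.
rewrite hankel_fE det_corner_mul ?solution_coef0 //.
rewrite corner_block; last exact: fps2_1_supp.
by rewrite det_lblock corner1_1 det1 mul1r.
Qed.

Definition bordered_det N k : K :=
  \det (corner N (hankel_fps f + inX (border k) * inY (border k))).

(** After the first division the blocks are 1 and b times the tail, with border (1, h_k).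
    Singularity of the second block lets [det_block_rank1] discard the perturbation of the first,
    whose determinant is 1. *)
Lemma bordered_detS r k :
  \det (corner r (inX (c b) * hankel_fps tail)) = 0 ->
  bordered_det (1 + r) k =
  \det (corner r (inX (c b) * hankel_fps tail
                 + inX (border_tail k) * inY (border_tail k))).
Proof.
move=> d0; rewrite /bordered_det.
have -> : hankel_fps f + inX (border k) * inY (border k) = inX f * inY f *
    (1 + inX z * inY z * (inX (c b) * hankel_fps tail) +
     inX (1 + z * border_tail k) * inY (1 + z * border_tail k)).
  by rewrite borderE !rmorphM /= {1}hankel_fE; ring.
rewrite det_corner_mul ?solution_coef0 // cornerD corner_rank1 corner_block.
  rewrite fps_col_block; last by case.
  by rewrite det_block_rank1 // corner1_1 det1 mul1r cornerD corner_rank1.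
exact: fps2_1_supp.
Qed.

Lemma antidiag_coef i j : antidiag j i =
  (i + j == s.+1)%N%:R - a * ((0 < i)%N && (0 < j)%N && (i + j == s.+2)%N)%:R.
Proof.
rewrite /antidiag fpsDE fpsNE fpsDE fpsNE inX_mulE fps_cstM inX_XnE.
congr (_ - a * _); case: i => [|i] //; rewrite inY_XnE.
case: j => [|j] //=; rewrite /hankel_fps /fps_Xn !subn1 /=.
by congr (nat_of_bool _)%:R; apply/eqP/eqP; lia.
Qed.

Lemma antidiag_supp i j : (s.+2 <= i)%N || (s.+2 <= j)%N -> antidiag j i = 0.
Proof.
move=> h; rewrite antidiag_coef.
have -> : (i + j == s.+1)%N = false by lia.
have -> : (0 < i)%N && (0 < j)%N && (i + j == s.+2)%N = false by lia.
by rewrite mulr0 subr0.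
Qed.

Lemma det_antidiag : \det (corner s.+2 antidiag) = (-1) ^+ 'C(s.+2, 2).
Proof.
apply: det_antitriangular => i j ij; rewrite mxE antidiag_coef.
  have -> : (i + j == s.+1)%N = false by move: ij => /=; lia.
  have -> : (i + j == s.+2)%N = false by move: ij => /=; lia.
  by rewrite andbF mulr0 subr0.
rewrite ij /= eqxx (_ : (_ == s.+2) = false); last by lia.
by rewrite andbF mulr0 subr0.
Qed.

Lemma tail_block : inX (c b) * hankel_fps tail = inX f * inY f *
  (inX (c b) * antidiag + inX (fps_Xn s.+2) * inY (fps_Xn s.+2) *
     (inX (c b) * (inX (c b) * hankel_fps f))).
Proof. by rewrite hankel_tailE; ring. Qed.

Lemma b_antidiag_supp i j : (s.+2 <= i)%N || (s.+2 <= j)%N ->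
  (inX (c b) * antidiag) j i = 0.
Proof. by move=> h; rewrite inX_mulE fps_cstM antidiag_supp ?mulr0. Qed.

Lemma det_tail_block N :
  \det (corner (s.+2 + N) (inX (c b) * hankel_fps tail)) =
  b ^+ s.+2 * (-1) ^+ 'C(s.+2, 2) * (b ^+ (2 * N) *
    \det (corner N (hankel_fps f))).
Proof.
rewrite tail_block det_corner_mul ?solution_coef0 //.
rewrite corner_block; last exact: b_antidiag_supp.
rewrite det_lblock !cornerZ !detZ det_antidiag.
by rewrite mulrA -expr2 exprAC exprM.
Qed.

Lemma det_hankel_step N : \det (corner (s.+3 + N) (hankel_fps f)) =
  b ^+ s.+2 * (-1) ^+ 'C(s.+2, 2) * (b ^+ (2 * N) *
    \det (corner N (hankel_fps f))).
Proof. by rewrite -det_tail_block -det_hankelS. Qed.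

(** Both divisions are combined: the vanishing assumed in size N makes the last block singular, and
    through [det_tail_block] it also gives the singularity required by [bordered_detS]. *)
Lemma bordered_det_step N k : \det (corner N (hankel_fps f)) = 0 ->
  bordered_det (s.+3 + N) k =
  b ^+ s.+2 * (-1) ^+ 'C(s.+2, 2) * (b ^+ (2 * N) * bordered_det N k.+1).
Proof.
move=> d0; rewrite (@bordered_detS (s.+2 + N)); last first.
  by rewrite det_tail_block d0 !mulr0.
set w := - c (k.+1%:R * a) * (1 - c a * z).
set w2 := - c b * border k.+1.
have -> : inX (c b) * hankel_fps tail
    + inX (border_tail k) * inY (border_tail k) = inX f * inY f *
    (inX (c b) * antidiag + inX (fps_Xn s.+2) * inY (fps_Xn s.+2) *
     (inX (c b) * (inX (c b) * hankel_fps f)) +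
     inX (w + fps_Xn s.+2 * w2) * inY (w + fps_Xn s.+2 * w2)).
  by rewrite tail_block border_tailE -/w -/w2 !rmorphM /=; ring.
rewrite det_corner_mul ?solution_coef0 // cornerD corner_rank1.
rewrite corner_block; last exact: b_antidiag_supp.
rewrite fps_col_block => [|i si]; last first.
  rewrite /w mulNr fpsNE fps_cstM fpsDE fpsNE fps_cstM fps1E /fps_Xn.
  have -> : (i == 0%N) = false by lia.
  have -> : (i == 1%N) = false by lia.
  by rewrite mulr0 subr0 mulr0 oppr0.
rewrite det_block_rank1; last by rewrite !cornerZ !detZ d0 !mulr0.
rewrite cornerZ detZ det_antidiag -corner_rank1 -cornerD.
(* The factor -b occurs twice in the rank-one term, so b^2 comes out of both summands. *)
have -> : inX (c b) * (inX (c b) * hankel_fps f) + inX w2 * inY w2 =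
    inX (c b) * (inX (c b) *
      (hankel_fps f + inX (border k.+1) * inY (border k.+1))).
  by rewrite /w2 !rmorphM !rmorphN /= inY_cst; ring.
by rewrite !cornerZ !detZ mulrA -expr2 exprAC exprM.
Qed.

(** * Initial sizes, vanishing minors and closed forms *)

(** The first row is zero, because the tail starts in degree s + 1. *)
Lemma tail_corner0 r : (r <= s)%N ->
  \det (corner (1 + r) (inX (c b) * hankel_fps tail)) = 0.
Proof.
move=> rs; rewrite cornerZ detZ (expand_det_row _ ord0) big1 ?mulr0 // => j _.
rewrite mxE /hankel_fps /tail fps_XnM.
by rewrite (_ : _ <= _ = false)%N ?mul0r //; case: j => j /=; lia.
Qed.

(** In this range the tail block has zero first row and column, and h_k reduces to the constant
    -(k+1) a, so the perturbation only fills the corner entry with its square. *)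
Lemma bordered_det_base r k : (r <= s)%N ->
  bordered_det (1 + (1 + r)) k = (k.+1%:R * a) ^+ 2 *
    (b ^+ r * \det (\matrix_(i < r, j < r) tail (i + j).+2)).
Proof.
move=> rs; rewrite bordered_detS ?tail_corner0 //.
rewrite cornerD cornerZ corner_rank1.
set M := _ + _.
have -> : M = block_mx ((k.+1%:R * a) ^+ 2)%:M 0 0
    (b *: (\matrix_(i < r, j < r) tail (i + j).+2)).
  have t0 n : (n <= s)%N -> tail n = 0.
    by move=> ns; rewrite /tail fps_XnM leqNgt ltnS ns.
  have bt n : (n <= s)%N -> border_tail k n = - (k.+1%:R * a) *+ (n == 0%N).
    move=> ns; rewrite /border_tail fpsDE !fpsNE fps_cstM fps_XnM.
    by rewrite (_ : (s.+2 <= n)%N = false) ?mulr0 ?subr0 ?mulNrn //; lia.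
  apply/matrixP => i j; rewrite /M.
  case: (split_ordP i) => i' ->; case: (split_ordP j) => j' ->;
    rewrite ?block_mxEul ?block_mxEur ?block_mxEdl ?block_mxEdr !mxE big_ord1
            !mxE /hankel_fps.
  - by rewrite !ord1 /= t0 // bt //= mulr0 add0r mulrNN expr2 mulr1n.
  - rewrite !ord1 /= t0 ?(bt j'.+1) //= ?mulr0n ?mulr0 ?addr0 //;
      by case: j' => j' /=; lia.
  - rewrite !ord1 /= t0 ?(bt i'.+1) //= ?mulr0n ?mulr0 ?mul0r ?addr0 //;
      by case: i' => i' /=; lia.
  - rewrite /= (bt i'.+1) ?mulr0n ?mul0r ?addr0 /=.
      by rewrite !add1n addnS addSn.
    by case: i' => i' /=; lia.
by rewrite det_ublock det_scalar1 detZ.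
Qed.

(** The extreme values r = 0 and r = s give the sizes mn + 2 and m(n + 1) - 1 used below. *)
Lemma det_hankel0 r n : (r <= s)%N ->
  \det (corner (s.+3 * n + (1 + (1 + r))) (hankel_fps f)) = 0.
Proof.
move=> rs; elim: n => [|n IH].
  by rewrite muln0 add0n det_hankelS tail_corner0.
by rewrite mulnS -addnA det_hankel_step IH !mulr0.
Qed.

(** The index k stays general in the induction because each step raises it while lowering n; the sum
    k + n is invariant, and k = 0 yields the factor (n + 1)^2. *)
Lemma bordered_det_add2 n k :
  bordered_det (s.+3 * n + 2) k =
  (-1) ^+ (n * 'C(s.+2, 2)) * ((k + n).+1%:R * a) ^+ 2
    * b ^+ (s.+3 * n ^ 2 + 3 * n).
Proof.
elim: n k => [|n IH] k.
  have -> : (s.+3 * 0 ^ 2 + 3 * 0 = 0)%N by lia.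
  rewrite muln0 add0n (@bordered_det_base 0) // det_mx00 !expr0 !mulr1.
  by rewrite addn0 mul1r.
rewrite mulnS -addnA bordered_det_step ?(@det_hankel0 0) // IH.
rewrite addSnnS mulSn exprD.
have -> : (s.+3 * n.+1 ^ 2 + 3 * n.+1 =
    s.+2 + 2 * (s.+3 * n + 2) + (s.+3 * n ^ 2 + 3 * n))%N by lia.
by rewrite !exprD; ring.
Qed.

Lemma bordered_det_pred n k :
  bordered_det (s.+3 * n + s.+2) k =
  - ((-1) ^+ (n.+1 * 'C(s.+2, 2)) * ((k + n).+1%:R * a) ^+ 2
    * b ^+ (s.+3 * n.+1 ^ 2 - 3 * n.+1)).
Proof.
elim: n k => [|n IH] k.
  rewrite muln0 add0n (@bordered_det_base s) // det_antitriangular.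
  - rewrite addn0 mul1n (_ : _ - _ = s)%N; last by lia.
    (* The base block has size s rather than s + 2; the two binomials differ by the odd number 2s +
       1, whence the minus sign of the second formula. *)
    have -> : (-1) ^+ 'C(s.+2, 2) = - (-1) ^+ 'C(s, 2) :> K.
      rewrite (_ : 'C(s.+2, 2) = ('C(s, 2) + (s + s).+1)%N).
        by rewrite exprD exprS exprD -expr2 sqrr_sign mulr1 mulrN1.
      by rewrite (binS s.+1) (binS s 1) !bin1; lia.
    by ring.
  - by move=> i j ij; rewrite mxE /tail fps_XnM (_ : _ <= _ = false)%N //; lia.
  - move=> i j ij; rewrite mxE /tail fps_XnM.
    (* The existence of [i] in ['I_s] forces s > 0, so [s.-1] is a true predecessor. *)
    have -> : (i + j).+2 = s.+1 by case: i ij => i /=; lia.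
    by rewrite leqnn subnn solution_coef0.
rewrite mulnS -addnA bordered_det_step ?(@det_hankel0 s) // IH.
rewrite addSnnS [(n.+2 * _)%N]mulSn.
have -> : (s.+3 * n.+2 ^ 2 - 3 * n.+2 =
    s.+2 + 2 * (s.+3 * n + s.+2) + (s.+3 * n.+1 ^ 2 - 3 * n.+1))%N by lia.
by rewrite !exprD; ring.
Qed.

(** * Return to the shifted Hankel determinant *)

(** As g_0 = 1, the border only adds 1 to the entry (0, 0). Expanding along the first row, the
    difference is the cofactor of that entry, whose matrix has entries f (i + j + 2). *)
Lemma hankel_det2E N : hankel_det 2 f N =
  bordered_det (1 + N) 0 - \det (corner (1 + N) (hankel_fps f)).
Proof.
have b1 : border 0 = 1 by rewrite /border mul0r raddf0 mul0r subr0.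
rewrite /bordered_det b1 !rmorph1 mulr1.
set A := corner _ (_ + 1); set H := corner _ (hankel_fps f).
have cofE j : cofactor A ord0 j = cofactor H ord0 j.
  congr (_ * \det _); apply/matrixP => p q.
  by rewrite !mxE !fpsDE fps2_1_supp // addr0.
have A0 j : A ord0 j = H ord0 j + (j == ord0)%:R.
  by rewrite !mxE !fpsDE fps1E; case: j => -[|j].
rewrite (expand_det_row A ord0) (expand_det_row H ord0) -sumrB.
rewrite (bigD1 ord0) //= big1 => [|j /negbTE j0]; last first.
  by rewrite A0 cofE j0 addr0 subrr.
rewrite addr0 A0 cofE eqxx mulrDl addrC addKr mul1r /cofactor expr0 mul1r.
congr (\det _); apply/matrixP => i j; rewrite !mxE /hankel_fps.
by rewrite !lift0 addn2 addSn addnS.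
Qed.

End Recursion.

Theorem theorem7p4 (R : realType) (m : nat) (a b : R[i]) (f : fps R[i]) :
  (4 <= m)%N ->
  f = (1 + a *: ('z * f) + b *: ('z^m * (f * f)))%fps ->
  (forall n : nat,
     hankel_det 2 f (m * n + 1) =
       (-1) ^+ (n * 'C(m - 1, 2)) * (n + 1)%:R ^+ 2 * a ^+ 2
         * b ^+ (m * n ^ 2 + 3 * n))
  /\
  (forall n : nat, (1 <= n)%N ->
     hankel_det 2 f (m * n - 2) =
       - ((-1) ^+ (n * 'C(m - 1, 2)) * n%:R ^+ 2 * a ^+ 2
         * b ^+ (m * n ^ 2 - 3 * n))).
Proof.
case: m => [|[|[|s]]] // _; rewrite !fps_scaleE => fE.
rewrite subn1 /=; split=> [n|[//|n] _].
  rewrite (hankel_det2E a) addnCA (bordered_det_add2 fE).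
  by rewrite (@det_hankel0 _ s _ _ _ fE 0) // subr0 add0n addn1 exprMn !mulrA.
(* Here n stands for the original index minus 1, so the bordered size is mn + (m - 1). *)
rewrite (_ : _ - 2 = s.+3 * n + s.+1)%N; last by lia.
rewrite (hankel_det2E a) addnCA add1n (bordered_det_pred fE).
by rewrite (@det_hankel0 _ s _ _ _ fE s) // subr0 add0n exprMn !mulrA.
Qed.
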